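(* Let $d\ge 1$ be an integer and let $\eta_0>0$, $\xi>0$, $k_c>0$ and $\eta_1\in\mathbb{R}$. Put $\Delta=|\eta_1^2-4|^{1/2}$. The FGC-SSRF on $\mathbb{R}^d$ with parameters $(\eta_0,\eta_1,\xi,k_c)$ is permissible in each of the following cases: (i) $\eta_1>-2$, for any $k_c$; (ii) $\eta_1<-2$, provided that $k_c\,\xi<\frac{1}{\sqrt{2}}\sqrt{|\eta_1|-\Delta}$.
   Context: The fluctuation-gradient-curvature Spartan spatial random field (FGC-SSRF) on $\mathbb{R}^d$ with parameters $\eta_0>0$ (scale), $\eta_1\in\mathbb{R}$ (shape), $\xi>0$ (characteristic length) and $k_c>0$ (band cutoff) is the stationary, zero-mean Gaussian model specified by the covariance spectral density $$\tilde G(\mathbf{k})=\frac{\eta_0\,\xi^d}{1+\eta_1(k\xi)^2+(k\xi)^4}\,|\tilde Q(\mathbf{k})|^2,\qquad k=|\mathbf{k}|,\ \mathbf{k}\in\mathbb{R}^d,$$ where $\tilde Q$ is the boxcar kernel: $\tilde Q(\mathbf{k})=1$ if $|\mathbf{k}|\le k_c$ and $\tilde Q(\mathbf{k})=0$ otherwise. The corresponding covariance function is $$G(\mathbf{r})=\frac{1}{(2\pi)^d}\int_{\mathbb{R}^d}e^{i\mathbf{k}\cdot\mathbf{r}}\,\tilde G(\mathbf{k})\,d\mathbf{k}.$$ The model is called permissible if $G$ is a well-defined covariance function, i.e. it is positive definite in the sense of Bochner: $\sum_{i,j}c_i\overline{c_j}\,G(\mathbf{s}_i-\mathbf{s}_j)\ge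 0$ for all finite families of points $\mathbf{s}_i\in\mathbb{R}^d$ and $c_i\in\mathbb{C}$. *)

(* Defs.v *)
From HB Require Import structures.
From mathcomp Require Import all_boot all_order all_algebra.
From mathcomp Require Import all_classical all_reals all_analysis.
From mathcomp Require Import complex.

Set Implicit Arguments.
Unset Strict Implicit.
Unset Printing Implicit Defensive.
Import Order.TTheory GRing.Theory Num.Theory.
Import numFieldNormedType.Exports.

Local Open Scope classical_set_scope.
Local Open Scope ring_scope.
Local Open Scope complex_scope.

Section lebesgue_cons.
Context (R : realType) (n : nat).
Variable mu : {sigma_finite_measure set (n.-tuple (measurableTypeR R)) -> \bar R}.

Definition tuple_cons (p : measurableTypeR R * n.-tuple (measurableTypeR R)) :
  n.+1.-tuple (measurableTypeR R) := [tuple of p.1 :: p.2].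

Lemma measurable_tuple_cons : measurable_fun setT tuple_cons.
Proof. exact: measurable_cons. Qed.

Definition lebesgue_cons : set (n.+1.-tuple (measurableTypeR R)) -> \bar R :=
  pushforward (lebesgue_measure \x mu)%E tuple_cons.

Let lebesgue_cons0 : lebesgue_cons set0 = 0%E.
Proof. by rewrite /lebesgue_cons /pushforward preimage_set0 measure0. Qed.

Let lebesgue_cons_ge0 A : (0 <= lebesgue_cons A)%E.
Proof. exact: (@measure_ge0 _ _ _ (lebesgue_measure \x mu)%E). Qed.

Let lebesgue_cons_sigma_additive : semi_sigma_additive lebesgue_cons.
Proof.
move=> F mF tF mUF; rewrite /lebesgue_cons /pushforward preimage_bigcup.
have mpre A : measurable A -> measurable (tuple_cons @^-1` A).
  by move=> mA; rewrite -[X in measurable X]setTI; exact: measurable_tuple_cons.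
apply: (@measure_semi_sigma_additive _ _ _ (lebesgue_measure \x mu)%E).
- by move=> k; exact: mpre.
- apply/trivIsetP => /= i j _ _ ij; rewrite -preimage_setI.
  by move/trivIsetP : tF => /(_ _ _ _ _ ij) ->//; rewrite preimage_set0.
- by rewrite -preimage_bigcup; exact: mpre.
Qed.

HB.instance Definition _ := isMeasure.Build _ _ _ lebesgue_cons
  lebesgue_cons0 lebesgue_cons_ge0 lebesgue_cons_sigma_additive.

Let lebesgue_cons_sigma_finite : sigma_finite setT lebesgue_cons.
Proof.
have /sigma_finiteP[F [FT ndF Foo]] := sigma_finiteT (@lebesgue_measure R).
have /sigma_finiteP[G [GT ndG Goo]] := sigma_finiteT mu.
pose u (t : n.+1.-tuple (measurableTypeR R)) :
  measurableTypeR R * n.-tuple (measurableTypeR R) :=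
  (thead t, [tuple of behead t]).
have mu_ : measurable_fun setT u.
  apply/measurable_fun_pair; first exact: measurable_tnth.
  exact: measurable_behead.
have uK : cancel tuple_cons u.
  move=> [x t]; rewrite /u /tuple_cons; congr pair; exact/val_inj.
exists (fun k => u @^-1` (F k `*` G k)).
  rewrite -preimage_bigcup; apply/esym/seteqP; split=> // t _ /=.
  have [i _ Fi] : (\bigcup_k F k) (u t).1 by rewrite -FT.
  have [j _ Gj] : (\bigcup_k G k) (u t).2 by rewrite -GT.
  exists (maxn i j) => //; split.
  - by move: Fi; exact/subsetPset/ndF/leq_maxl.
  - by move: Gj; exact/subsetPset/ndG/leq_maxr.
move=> k; have [mFk Fk] := Foo k; have [mGk Gk] := Goo k; split.
  by rewrite -[X in measurable X]setTI; apply: mu_ => //; exact: measurableX.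
rewrite /lebesgue_cons /pushforward -comp_preimage.
rewrite (_ : u \o tuple_cons = idfun); last by apply/funext => p /=; rewrite uK.
by rewrite preimage_id product_measure1E// lte_mul_pinfty// ge0_fin_numE.
Qed.

HB.instance Definition _ := Measure_isSigmaFinite.Build _ _ _ lebesgue_cons
  lebesgue_cons_sigma_finite.

End lebesgue_cons.

(* The n-dimensional Lebesgue measure, as an iterated product measure. *)
Fixpoint lebesgue_tuple (R : realType) (n : nat) :
    {sigma_finite_measure set (n.-tuple (measurableTypeR R)) -> \bar R} :=
  if n is m.+1 then lebesgue_cons (lebesgue_tuple R m) else dirac [tuple].

Lemma lebesgue_tuple_box (R : realType) (n : nat)
    (A : 'I_n -> set (measurableTypeR R)) :
  (forall i, measurable (A i)) ->
  lebesgue_tuple R n [set t | forall i, A i (tnth t i)] =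
  (\prod_(i < n) lebesgue_measure (A i))%E.
Proof.
elim: n A => [|n IHn] A mA.
  rewrite big_ord0 /= diracE mem_set//=.
  by move=> [].
rewrite big_ord_recl /= /lebesgue_cons /pushforward.
have mbox : measurable [set t | forall i, A (lift ord0 i) (tnth t i)].
  rewrite [X in measurable X](_ : _ =
      \bigcap_(i in [set: 'I_n]) ((fun t => tnth t i) @^-1` A (lift ord0 i))).
    apply: fin_bigcap_measurable => // i _.
    by rewrite -[X in measurable X]setTI; exact: measurable_tnth.
  by apply/seteqP; split=> [t At i _|t At i]; exact: At.
rewrite -IHn// -product_measure1E//.
congr (_ _); apply/seteqP; split=> [[x t] /= At|[x t] /= [Ax At] i].
  by split=> [|i]; [have := At ord0|have := At (lift ord0 i); rewrite tnthS].
by case: (unliftP ord0 i) => [j ->|->] //; rewrite tnthS.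
Qed.

Section FGC_SSRF.
Context {R : realType} {d : nat}.
Implicit Types (k r u v : 'rV[R]_d) (f : 'rV[R]_d -> R[i]).

Definition dot u v : R := \sum_(i < d) u 0 i * v 0 i.

(* The norm that MathComp-Analysis puts on 'rV[R]_d is the sup norm. *)
Definition enorm u : R := Num.sqrt (dot u u).

Definition row_of_tuple (t : d.-tuple (measurableTypeR R)) : 'rV[R]_d :=
  \row_i tnth t i.

Definition complex_integrable f : Prop :=
  (lebesgue_tuple R d).-integrable setT
    (fun t => (complex.Re (f (row_of_tuple t)))%:E) /\
  (lebesgue_tuple R d).-integrable setT
    (fun t => (complex.Im (f (row_of_tuple t)))%:E).

Definition complex_integral f : R[i] :=
  (\int[lebesgue_tuple R d]_t complex.Re (f (row_of_tuple t))) +i*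
  (\int[lebesgue_tuple R d]_t complex.Im (f (row_of_tuple t))).

Definition expi (x : R) : R[i] := cos x +i* sin x.

Definition boxcar (kc : R) k : R := if enorm k <= kc then 1 else 0.

Definition spectral_density (eta0 eta1 xi kc : R) k : R :=
  eta0 * xi ^+ d / (1 + eta1 * (enorm k * xi) ^+ 2 + (enorm k * xi) ^+ 4)
  * `|boxcar kc k| ^+ 2.

Definition fourier_integrand (eta0 eta1 xi kc : R) r k : R[i] :=
  expi (dot k r) * (spectral_density eta0 eta1 xi kc k)%:C.

Definition ssrf_covariance (eta0 eta1 xi kc : R) r : R[i] :=
  (((2 * pi) ^+ d)^-1)%:C *
  complex_integral (fourier_integrand eta0 eta1 xi kc r).

(* In the order of R[i], 0 <= z means that z is real and nonnegative. *)
Definition positive_definite (G : 'rV[R]_d -> R[i]) : Prop :=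
  forall (n : nat) (s : 'I_n -> 'rV[R]_d) (c : 'I_n -> R[i]),
    0 <= \sum_(i < n) \sum_(j < n) c i * (c j)^* * G (s i - s j).

End FGC_SSRF.

(* The integrability clause says that the covariance is well defined: the
   library's integral has a default value on non-integrable functions. For
   0 < d it also excludes zeros of the denominator of the density in the
   closed band, since 1 / (x - a) is not integrable near a. *)
Definition permissible (R : realType) (d : nat) (eta0 eta1 xi kc : R) : Prop :=
  (forall r : 'rV[R]_d,
     complex_integrable (fourier_integrand eta0 eta1 xi kc r)) /\
  positive_definite (@ssrf_covariance R d eta0 eta1 xi kc).

(* Main.v *)
(* With x = (k xi)^2, the denominator 1 + eta1 x + x^2 of the density is bounded
   below by a positive constant on the band: for eta1 > -2 on all x >= 0, and
   for eta1 < -2 as long as x stays below the smaller root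
   (|eta1| - Delta) / 2. Hence the spectral density is nonnegative, bounded and
   supported in a bounded set, so that it is integrable, and the quadratic form
   of G is the integral of |sum_i c_i exp(i k.s_i)|^2 against it. *)
Require Import Defs.
From mathcomp Require Import all_boot all_order all_algebra.
From mathcomp Require Import all_classical all_reals all_analysis.
From mathcomp Require Import measurable_realfun complex ring lra.
Import Order.TTheory GRing.Theory Num.Theory.
Local Open Scope ring_scope.

(** * Integrability by domination on a set of finite measure *)

Lemma bounded_support_integrable {dT} {T : measurableType dT} {R : realType}
    (mu : {measure set T -> \bar R}) (A : set T) (g : T -> R) (M : R) :
  measurable A -> (mu A < +oo)%E -> measurable_fun setT g ->
  (forall x, `|g x| <= M * \1_A x) -> mu.-integrable setT (EFin \o g).
Proof.
move=> mA Aoo mg gM.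
have intA : mu.-integrable setT (EFin \o (\1_A : T -> R)).
  apply/integrableP; split; first exact/measurable_EFinP.
  rewrite (eq_integral (fun x => (\1_A x)%:E)); last first.
    by move=> t _; rewrite gee0_abs// lee_fin.
  by rewrite integral_indic// setIT.
apply: (@le_integrable _ _ _ mu setT measurableT _
  (fun x => M%:E * (\1_A x)%:E)%E).
- exact/measurable_EFinP.
- move=> x _ /=; rewrite lee_fin; apply: le_trans (gM x) _; exact: ler_norm.
- exact: integrableZl.
Qed.

(** * Linearity and positivity of the complex integral *)

Section complex_integral_linearity.
Context {R : realType} {d : nat}.
Implicit Types f g : 'rV[R]_d -> R[i].

Lemma complex_integrable0 : complex_integrable (fun _ : 'rV[R]_d => 0 : R[i]).
Proof. by split; exact: integrable0. Qed.

Lemma complex_integrableD f g : complex_integrable f -> complex_integrable g ->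
  complex_integrable (fun k => f k + g k).
Proof.
move=> [f1 f2] [g1 g2]; split.
- apply: eq_integrable (integrableD measurableT f1 g1) => // t _ /=.
  by rewrite -EFinD; case: (f _) => ? ?; case: (g _).
- apply: eq_integrable (integrableD measurableT f2 g2) => // t _ /=.
  by rewrite -EFinD; case: (f _) => ? ?; case: (g _).
Qed.

Lemma complex_integralD f g : complex_integrable f -> complex_integrable g ->
  complex_integral (fun k => f k + g k) =
  complex_integral f + complex_integral g.
Proof.
move=> [f1 f2] [g1 g2].
have cD (a b a' b' : R) :
  Complex (a + a') (b + b') = Complex a b + Complex a' b' by [].
rewrite /complex_integral -cD -!RintegralD//; congr Complex.
- by apply: eq_Rintegral => t _; case: (f _) => ? ?; case: (g _).
- by apply: eq_Rintegral => t _; case: (f _) => ? ?; case: (g _).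
Qed.

(** Each of the two parts of [c * f] is a real linear combination of both parts of [f]. *)
Lemma complex_integrableZl (c : R[i]) f : complex_integrable f ->
  complex_integrable (fun k => c * f k).
Proof.
case: c => a b [f1 f2]; split.
- apply: eq_integrable
    (integrableB measurableT (integrableZl measurableT a f1)
                             (integrableZl measurableT b f2)) => // t _ /=.
  by rewrite -!EFinM -EFinB; case: (f _).
- apply: eq_integrable
    (integrableD measurableT (integrableZl measurableT a f2)
                             (integrableZl measurableT b f1)) => // t _ /=.
  by rewrite -!EFinM -EFinD; case: (f _) => x y.
Qed.

Lemma complex_integralZl (c : R[i]) f : complex_integrable f ->
  complex_integral (fun k => c * f k) = c * complex_integral f.
Proof.
case: c => a b [f1 f2].
have cM (x y : R) : Complex a b * Complex x y =
  Complex (a * x - b * y) (a * y + b * x) by [].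
rewrite /complex_integral cM -!RintegralZl//.
rewrite -RintegralB//; [|exact: (integrableZl measurableT a f1)
                        |exact: (integrableZl measurableT b f2)].
rewrite -RintegralD//; [|exact: (integrableZl measurableT a f2)
                        |exact: (integrableZl measurableT b f1)].
by congr Complex; apply: eq_Rintegral => t _; case: (f _).
Qed.

Lemma complex_integrable_sum (I : Type) (s : seq I)
    (h : I -> 'rV[R]_d -> R[i]) : (forall i, complex_integrable (h i)) ->
  complex_integrable (fun k => \sum_(i <- s) h i k).
Proof.
move=> hi; elim: s => [|i s ih].
  by under eq_fun do rewrite big_nil; exact: complex_integrable0.
by under eq_fun do rewrite big_cons; exact: complex_integrableD.
Qed.

Lemma complex_integral_sum (I : Type) (s : seq I)
    (h : I -> 'rV[R]_d -> R[i]) : (forall i, complex_integrable (h i)) ->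
  complex_integral (fun k => \sum_(i <- s) h i k) =
  \sum_(i <- s) complex_integral (h i).
Proof.
move=> hi; elim: s => [|i s ih].
  rewrite big_nil; under eq_fun do rewrite big_nil.
  by rewrite /complex_integral /= Rintegral_cst// mul0r.
rewrite big_cons -ih -complex_integralD//; last exact: complex_integrable_sum.
by under eq_fun do rewrite big_cons.
Qed.

Lemma complex_integral_ge0 f : (forall k, 0 <= f k) -> 0 <= complex_integral f.
Proof.
move=> f0; rewrite lecE /=; apply/andP; split.
  (* In the order of [R[i]], [0 <= f k] forces the imaginary part of [f k] to vanish. *)
  rewrite /Rintegral integral0_eq// => t _.
  by have := f0 (row_of_tuple t); rewrite lecE => /andP[/eqP ->].
apply: Rintegral_ge0 => t _.
by have := f0 (row_of_tuple t); rewrite lecE => /andP[].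
Qed.

End complex_integral_linearity.

(** * The direct half of Bochner's theorem *)

Section bochner.
Context {R : realType} {d : nat}.
Implicit Types (k r u v : 'rV[R]_d) (S : 'rV[R]_d -> R).

Lemma dotBr k u v : dot k (u - v) = dot k u - dot k v.
Proof.
rewrite /dot -sumrB; apply: eq_bigr => i _.
by rewrite !mxE mulrBr.
Qed.

Lemma expiB (x y : R) : expi (x - y) = expi x * (expi y)^*%C.
Proof. by rewrite /expi cosB sinB; simpc; congr Complex; ring. Qed.

(** By linearity the finite double sum moves under the integral, where the integrand becomes a
    squared modulus times [S k], hence nonnegative at each [k]. *)
Lemma positive_definite_fourier S (C : R) : (forall k, 0 <= S k) -> 0 <= C ->
  (forall r, complex_integrable (fun k => expi (dot k r) * (S k)%:C%C)) ->
  positive_definite (fun r =>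
    C%:C%C * complex_integral (fun k => expi (dot k r) * (S k)%:C%C)).
Proof.
move=> S0 C0 intS n s c.
pose h i j k := c i * (c j)^*%C * (expi (dot k (s i - s j)) * (S k)%:C%C).
have inth i j : complex_integrable (h i j) by exact: complex_integrableZl.
have -> : \sum_(i < n) \sum_(j < n) c i * (c j)^*%C * (C%:C%C *
      complex_integral (fun k => expi (dot k (s i - s j)) * (S k)%:C%C)) =
    C%:C%C * complex_integral (fun k => \sum_(i < n) \sum_(j < n) h i j k).
  rewrite complex_integral_sum; last by move=> i; exact: complex_integrable_sum.
  rewrite mulr_sumr; apply: eq_bigr => i _.
  rewrite complex_integral_sum// mulr_sumr; apply: eq_bigr => j _.
  by rewrite complex_integralZl// mulrCA.
apply: mulr_ge0; first by rewrite ler0c.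
apply: complex_integral_ge0 => k.
(* The phase of [s i - s j] is the phase of [s i] times the conjugate phase of [s j], so the double
   sum factors through [z] and its conjugate. *)
pose z := \sum_(i < n) c i * expi (dot k (s i)).
have -> : \sum_(i < n) \sum_(j < n) h i j k = z * z^*%C * (S k)%:C%C.
  rewrite rmorph_sum /= !mulr_suml; apply: eq_bigr => i _.
  rewrite mulr_sumr mulr_suml; apply: eq_bigr => j _.
  by rewrite /h dotBr expiB rmorphM /=; ring.
by apply: mulr_ge0; [exact: mulcJ_ge0|rewrite ler0c].
Qed.

End bochner.

(** * Measurability and integrability of band-limited functions *)

Section band_limited.
Local Open Scope classical_set_scope.
Context {R : realType} {d : nat}.

Lemma measurable_dot_row (r : 'rV[R]_d) : measurable_fun setT
  (fun t : d.-tuple (measurableTypeR R) => dot (row_of_tuple t) r).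
Proof.
apply: measurable_sum => i; apply: measurable_funM => //.
under eq_fun do rewrite mxE; exact: measurable_tnth.
Qed.

Lemma measurable_enorm_row : measurable_fun setT
  (fun t : d.-tuple (measurableTypeR R) => enorm (row_of_tuple t)).
Proof.
apply: (@measurableT_comp _ _ _ _ _ _ (@Num.sqrt R)).
  by apply: continuous_measurable_fun; exact: sqrt_continuous.
apply: measurable_sum => i; apply: measurable_funM;
  under eq_fun do rewrite mxE; exact: measurable_tnth.
Qed.

Lemma normr_coord_le_enorm (u : 'rV[R]_d) (i : 'I_d) : `|u 0 i| <= enorm u.
Proof.
rewrite -sqrtr_sqr ler_wsqrtr// /dot (bigD1 i)//= expr2 lerDl.
by apply: sumr_ge0 => j _; rewrite -expr2 sqr_ge0.
Qed.

(** The cube with sides [[- K, K]] serves: each coordinate is bounded by the Euclidean norm, and the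
    measure of a box is a finite product of finite lengths. *)
Lemma ball_finite_cover (K : R) :
  exists A : set (d.-tuple (measurableTypeR R)),
  [/\ measurable A, (lebesgue_tuple R d A < +oo)%E &
      forall t, enorm (row_of_tuple t) <= K -> A t].
Proof.
exists [set t : d.-tuple (measurableTypeR R) |
  forall i : 'I_d, `[- K, K] (tnth t i)]; split.
- rewrite [X in measurable X](_ : _ = \bigcap_(i in [set: 'I_d])
      ((fun t : d.-tuple (measurableTypeR R) => tnth t i) @^-1` `[- K, K])).
    apply: fin_bigcap_measurable => // i _.
    by rewrite -[X in measurable X]setTI; exact: measurable_tnth.
  by apply/seteqP; split=> [t At i _|t At i]; exact: At.
- rewrite (@lebesgue_tuple_box R d (fun=> `[- K, K]))// -ge0_fin_numE.
    apply: prode_fin_num => i _; rewrite lebesgue_measure_itv /=.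
    by case: ifP.
  by apply: prode_ge0 => i _; exact: measure_ge0.
- move=> t tK i /=; rewrite in_itv /= -ler_norml.
  by have := normr_coord_le_enorm (row_of_tuple t) i; rewrite mxE => /le_trans->.
Qed.

Lemma band_limited_complex_integrable (S : 'rV[R]_d -> R) (M K : R) :
  measurable_fun setT
    (fun t : d.-tuple (measurableTypeR R) => S (row_of_tuple t)) ->
  (forall k, `|S k| <= M) -> (forall k, K < enorm k -> S k = 0) ->
  forall r, complex_integrable (fun k => expi (dot k r) * (S k)%:C%C).
Proof.
move=> mS SM S0 r.
have [A [mA Aoo KA]] := ball_finite_cover K.
(* Stated for a general [g] bounded by 1, to be used with [cos] for the real part and [sin] for the
   imaginary part. *)
have bound (g : R -> R) (mg : measurable_fun setT g)
    (g1 : forall x, `|g x| <= 1) :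
    (lebesgue_tuple R d).-integrable setT (EFin \o (fun t =>
      g (dot (row_of_tuple t) r) * S (row_of_tuple t))).
  apply: (@bounded_support_integrable _ _ _ _ A _ M) => //.
    apply: measurable_funM => //.
    by apply: measurableT_comp => //; exact: measurable_dot_row.
  move=> t; rewrite normrM; have [tK|Kt] := leP (enorm (row_of_tuple t)) K.
    rewrite indicE mem_set ?mulr1; last exact: KA.
    by rewrite -[leRHS]mul1r ler_pM.
  (* Beyond [K] only [0 <= M] is needed, and it follows from the bound on [S] at the origin. *)
  rewrite S0// normr0 mulr0 mulr_ge0// (le_trans _ (SM 0))//.
split.
- apply: eq_integrable (bound cos _ (@cos_max R)) => //.
    by move=> t _ /=; rewrite mulr0 subr0.
  by apply: continuous_measurable_fun; exact: continuous_cos.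
- apply: eq_integrable (bound sin _ (@sin_max R)) => //.
    by move=> t _ /=; rewrite mulr0 add0r.
  by apply: continuous_measurable_fun; exact: continuous_sin.
Qed.

End band_limited.

(** * Permissibility from a lower bound on the denominator *)

Section spectral_density.
Context {R : realType} {d : nat}.
Variables eta0 eta1 xi kc m : R.
Hypotheses (eta0_ge0 : 0 <= eta0) (xi_ge0 : 0 <= xi) (m_gt0 : 0 < m).
Let den (k : 'rV[R]_d) := 1 + eta1 * (enorm k * xi) ^+ 2 + (enorm k * xi) ^+ 4.
Hypothesis den_ge : forall k, enorm k <= kc -> m <= den k.
Let S := @spectral_density R d eta0 eta1 xi kc.

Lemma spectral_densityE (k : 'rV[R]_d) :
  S k = if enorm k <= kc then eta0 * xi ^+ d / den k else 0.
Proof.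
rewrite /S /spectral_density /boxcar; case: ifP => _.
  by rewrite normr1 expr1n mulr1.
by rewrite normr0 expr0n mulr0.
Qed.

Lemma measurable_spectral_density : measurable_fun setT
  (fun t : d.-tuple (measurableTypeR R) => S (row_of_tuple t)).
Proof.
(* [powR _ (-1)] stands in for the inverse: its measurability is known, and the
   two agree where the denominator is nonnegative. *)
rewrite [X in measurable_fun _ X](_ : _ = (fun t =>
    if enorm (row_of_tuple t) <= kc
    then eta0 * xi ^+ d * powR (den (row_of_tuple t)) (-1) else 0)); last first.
  apply/funext => t; rewrite spectral_densityE; case: ifP => // /den_ge mden.
  by rewrite powR_inv1// (le_trans _ mden)// ltW.
have mn := @measurable_enorm_row R d.
apply: measurable_fun_ifT => //; first exact: measurable_fun_ler.
apply: measurable_funM => //.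
apply: (@measurableT_comp _ _ _ _ _ _ (fun x => powR x (-1))).
  exact: measurable_powR.
apply: measurable_funD; last by apply: measurable_funX; exact: measurable_funM.
apply: measurable_funD => //; apply: measurable_funM => //.
by apply: measurable_funX; exact: measurable_funM.
Qed.

Lemma spectral_density_ge0 (k : 'rV[R]_d) : 0 <= S k.
Proof.
rewrite spectral_densityE; case: ifP => // /den_ge mden.
by rewrite !mulr_ge0 ?exprn_ge0// invr_ge0 (le_trans _ mden)// ltW.
Qed.

Lemma spectral_density_le (k : 'rV[R]_d) : S k <= eta0 * xi ^+ d / m.
Proof.
have c0 : 0 <= eta0 * xi ^+ d by rewrite mulr_ge0 ?exprn_ge0.
rewrite spectral_densityE; case: ifP => [/den_ge mden|_].
  by rewrite ler_wpM2l// lef_pV2// posrE (lt_le_trans m_gt0).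
by rewrite divr_ge0// ltW.
Qed.

(** The lower bound [m] on the band makes the density nonnegative and at most [eta0 * xi ^+ d / m];
    this reduces permissibility to a question about a quadratic polynomial. *)
Lemma permissible_of_denominator_ge : permissible d eta0 eta1 xi kc.
Proof.
have intS (r : 'rV[R]_d) :
    complex_integrable (fun k => expi (dot k r) * (S k)%:C%C).
  apply: (@band_limited_complex_integrable _ _ _ (eta0 * xi ^+ d / m) kc).
  - exact: measurable_spectral_density.
  - by move=> k; rewrite ger0_norm ?spectral_density_le ?spectral_density_ge0.
  - by move=> k; rewrite ltNge spectral_densityE => /negbTE ->.
split; first exact: intS.
apply: positive_definite_fourier => //; first exact: spectral_density_ge0.
by rewrite invr_ge0 exprn_ge0// mulr_ge0// pi_ge0.
Qed.

End spectral_density.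

(** * Lower bounds for the quadratic [1 + eta1 * x + x ^+ 2] *)

Lemma denominator_gt_Nr2 {R : realFieldType} (eta1 : R) : -2 < eta1 ->
  exists2 m, 0 < m & forall x, 0 <= x -> m <= 1 + eta1 * x + x ^+ 2.
Proof.
move=> h; have [eta1_le|eta1_gt] := leP eta1 (-1).
  (* Completing the square leaves [1 - eta1 ^+ 2 / 4], which exceeds this witness by
     [(eta1 + 2) * - eta1 / 4]. *)
  exists ((eta1 + 2) / 2) => [|x _]; first lra.
  have := sqr_ge0 (x + eta1 / 2).
  have : 0 <= (eta1 + 2) * - eta1 by apply: mulr_ge0; lra.
  nra.
(* Here the quadratic equals [(x - 1 / 2) ^+ 2 + 3 / 4 + (eta1 + 1) * x]. *)
exists (1 / 2) => [|x x0]; first lra.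
have := sqr_ge0 (x - 1 / 2).
have : 0 <= (eta1 + 1) * x by apply: mulr_ge0; lra.
nra.
Qed.

(** By Vieta's relations [x1] and [x2] are the roots, so the quadratic is [(x1 - x) * (x2 - x)], and
    both factors are at least [x1 - X], which is positive. *)
Lemma denominator_ge_below_root {R : realFieldType} (eta1 x1 x2 X : R) :
  x1 + x2 = - eta1 -> x1 * x2 = 1 -> x1 <= x2 -> X < x1 ->
  forall x, x <= X -> (x1 - X) ^+ 2 <= 1 + eta1 * x + x ^+ 2.
Proof.
move=> s p x12 Xx1 x xX.
have -> : 1 + eta1 * x + x ^+ 2 = (x1 - x) * (x2 - x).
  by rewrite -p -[eta1]opprK -s; ring.
by rewrite expr2; apply: ler_pM; lra.
Qed.

(** * The two ranges of the shape parameter *)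

Theorem theorem1 (R : realType) (d : nat) (eta0 eta1 xi kc : R) :
  (1 <= d)%N -> 0 < eta0 -> 0 < xi -> 0 < kc ->
  let Delta := Num.sqrt `|eta1 ^+ 2 - 4| in
  (-2 < eta1 -> permissible d eta0 eta1 xi kc) /\
  (eta1 < -2 ->
   kc * xi < 1 / Num.sqrt 2 * Num.sqrt (`|eta1| - Delta) ->
   permissible d eta0 eta1 xi kc).
Proof.
move=> _ /ltW eta0_ge0 xi_gt0 kc_gt0 Delta; have xi_ge0 := ltW xi_gt0.
have pow4 (y : R) : y ^+ 4 = (y ^+ 2) ^+ 2 by rewrite -exprM.
split=> [/denominator_gt_Nr2[m m0 hm]|eta1_lt].
  apply: (permissible_of_denominator_ge _ _ _ _ m) => // k _.
  by rewrite pow4 hm// sqr_ge0.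
have eta1N : `|eta1| = - eta1 by rewrite ltr0_norm; lra.
rewrite eta1N => kxi.
have D0 : 0 <= Delta by exact: sqrtr_ge0.
have D2 : Delta ^+ 2 = eta1 ^+ 2 - 4.
  by rewrite sqr_sqrtr// ger0_norm//; nra.
(* Since [Delta ^+ 2] is smaller than [eta1 ^+ 2], the smaller root [(- eta1 - Delta) / 2] is
   positive. *)
have DltN : Delta < - eta1 by nra.
(* This is the squared form of [kxi], whose right-hand side is the square root of the smaller
   root. *)
have X_lt : (kc * xi) ^+ 2 < (- eta1 - Delta) / 2.
  rewrite -[ltRHS]sqr_sqrtr; last lra.
  rewrite ltr_pXn2r// ?nnegrE ?sqrtr_ge0 ?mulr_ge0 ?ltW//.
  rewrite sqrtrM; last lra.
  by rewrite sqrtrV// [ltRHS]mulrC -[X in _ < X * _]mul1r.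
apply: (permissible_of_denominator_ge _ _ _ _
  (((- eta1 - Delta) / 2 - (kc * xi) ^+ 2) ^+ 2)) => //.
  by rewrite exprn_gt0// subr_gt0.
move=> k kkc; rewrite pow4.
(* The second root is supplied; the product of the two is [(eta1 ^+ 2 - Delta ^+ 2) / 4], which is 1
   by [D2]. *)
apply: (@denominator_ge_below_root _ _ _ ((- eta1 + Delta) / 2)) => //.
- lra.
- by nra.
- lra.
- rewrite ler_pXn2r ?nnegrE ?mulr_ge0 ?sqrtr_ge0 ?(ltW kc_gt0)//.
  by rewrite ler_wpM2r.
Qed.
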